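(* Let $G_p$ and $G_c$ be IF-OFP systems with passivity indices $(\nu_p,\rho_p)$ and $(\nu_c,\rho_c)$ respectively, interconnected in the plant-side event-triggered feedback loop described in the context, where the triggering instants $t_k$ are determined by the condition $\|e_p(t)\|_2^2>\delta\|y_p(t)\|_2^2$ with $\delta\in(0,1]$, and let $w_2=0$. Let $$\beta(\nu_c)=\begin{cases}\rho_p-\nu_c-\delta(1+\nu_c)&\text{if }\nu_c>0,\\ \rho_p-\delta&\text{if }\nu_c=0,\\ \rho_p+2\nu_c-\delta(1-3\nu_c)&\text{if }\nu_c<0.\end{cases}$$ Then the networked control system is passive from $w_1$ to $y_p$ with input passivity index $\epsilon_0$ and output passivity index $\delta_0$, meaning $$\dot V(t)\le w_1^T(t)y_p(t)-\epsilon_0\,w_1^T(t)w_1(t)-\delta_0\,y_p^T(t)y_p(t)$$ for a storage function $V$ of the interconnection, where $$\epsilon_0<\min\Big(\nu_p,\ \frac{\nu_p(\rho_c-\frac14)}{\rho_c+\nu_p-\frac14}\Big),\qquad 0\le\delta_0\le\beta(\nu_c).$$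
   Context: Systems: a system $G$ has the form $\dot x=f(x,u)$, $y=h(x,u)$ with state $x\in X\subset\mathbb{R}^n$ and $u(t),y(t)\in\mathbb{R}^m$. A storage function is a nonnegative function $V$ of the state; it is taken differentiable, and $\dot V(t)$ is the time derivative along solutions. $G$ is IF-OFP (input feed-forward output feedback passive) with input passivity index $\nu\in\mathbb{R}$ and output passivity index $\rho\in\mathbb{R}$ (of either sign) if there is a storage function $V$ with $\dot V\le u^Ty-\rho y^Ty-\nu u^Tu$ for all $t$ along all solutions. Plant-side event-triggered loop: $G_p$ (plant, state $x_p$, input $u_p$, output $y_p$) has indices $(\nu_p,\rho_p)$, and $G_c$ (controller, state $x_c$, input $u_c$, output $y_c$) has indices $(\nu_c,\rho_c)$; all inputs and outputs are $\mathbb{R}^m$-valued. External signals $w_1,w_2$ are $\mathbb{R}^m$-valued. At event instants $t_k$ the plant output is sampled and sent to the controller, and is held constant until the next event. For $t\in[t_k,t_{k+1})$: $u_p(t)=w_1(t)-y_c(t)$, $u_c(t)=w_2(t)+y_p(t_k)$, $e_p(t)=y_p(t)-y_p(t_k)$ (so $u_c=w_2+y_p-e_p$). A new event is triggered as soon as $\|e_p(t)\|_2^2>\delta\|y_p(t)\|_2^2$ (Euclidean norm of the vectors at time $t$), so that $e_p^T(t)e_p(t)\le\delta\, y_p^T(t)y_p(t)$ holds at all times. A storage function of the interconnection is a nonnegative function $V$ of $(x_p,x_c)$; inequalities on $\dot V$ are required along all solutions for all $t$ in the intervals $[t_k,t_{k+1})$.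
   Formalization: The formal theorem additionally assumes ρ_c + ν_p − 1/4 > 0; when this quantity is 0 the bound on ε_0 is undefined, and when it is negative the claim can fail (e.g. y_p = u_p, y_c = −0.99u_c, indices (−10,1), (0,−100), δ = 1/2, ε_0 = −11, δ_0 = 1/2, w_1 = 1). *)

(* Defs.v *)
From HB Require Import structures.
From mathcomp Require Import all_boot all_order all_algebra.
From mathcomp Require Import all_classical all_reals all_analysis.

Set Implicit Arguments.
Unset Strict Implicit.
Unset Printing Implicit Defensive.

Import Order.TTheory GRing.Theory Num.Theory.
Import numFieldNormedType.Exports.

Local Open Scope classical_set_scope.
Local Open Scope ring_scope.

Definition dot (R : realType) (m : nat) (u v : 'cV[R]_m) : R :=
  (u^T *m v) 0 0.

(* Half-open time interval; the upper end may be +oo. *)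
Definition ico (R : realType) (a b : \bar R) : set R :=
  [set s | (a <= s%:E)%E /\ (s%:E < b)%E].

(* Derivative relative to the time set I: two-sided at the interior points of
   an interval, one-sided at an endpoint that belongs to it.  Sampled signals
   jump at event times, where only the right derivative of a state is
   meaningful. *)
Definition is_deriv_on (R : realType) (E : normedModType R) (I : set R)
    (g : R -> E) (t : R) (d : E) : Prop :=
  (s - t)^-1 *: (g s - g t) @[s --> within I t^'] --> d.

Definition rate_le (R : realType) (I : set R) (g : R -> R) (t b : R) : Prop :=
  exists2 d : R, is_deriv_on (E := R) I g t d & d <= b.

(* x' = dyn x u, y = out x u on the state set [states]; the values of dyn and
   out at points outside [states] are never used. *)
Record system (R : realType) (n m : nat) := System {
  states : set 'cV[R]_n;
  dyn : 'cV[R]_n -> 'cV[R]_m -> 'cV[R]_n;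
  out : 'cV[R]_n -> 'cV[R]_m -> 'cV[R]_m }.

Definition trajectory (R : realType) (n m : nat) (G : system R n m)
    (I : set R) (x : R -> 'cV[R]_n) (u y : R -> 'cV[R]_m) : Prop :=
  forall t, I t ->
    [/\ states G (x t), is_deriv_on I x t (dyn G (x t) (u t))
      & y t = out G (x t) (u t)].

Definition storage (R : realType) (E : normedModType R) (X : set E)
    (V : E -> R) : Prop :=
  forall x, X x -> 0 <= V x /\ differentiable V x.

Definition supply (R : realType) (m : nat) (nu rho : R)
    (u y : 'cV[R]_m) : R :=
  dot u y - rho * dot y y - nu * dot u u.

Definition IF_OFP (R : realType) (n m : nat) (G : system R n m)
    (nu rho : R) : Prop :=
  exists V : 'cV[R]_n -> R, storage (states G) V /\
    forall (a b : \bar R) (x : R -> 'cV[R]_n) (u y : R -> 'cV[R]_m),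
      trajectory G (ico a b) x u y ->
      forall t, ico a b t ->
        rate_le (ico a b) (V \o x) t (supply nu rho (u t) (y t)).

Record signals (R : realType) (np nc m : nat) := Signals {
  xp : R -> 'cV[R]_np;
  up : R -> 'cV[R]_m;
  yp : R -> 'cV[R]_m;
  xc : R -> 'cV[R]_nc;
  uc : R -> 'cV[R]_m;
  yc : R -> 'cV[R]_m }.

(* The feedback loop run on I with the plant output sample held at ys. *)
Definition held_loop (R : realType) (np nc m : nat)
    (Gp : system R np m) (Gc : system R nc m) (w1 w2 : R -> 'cV[R]_m)
    (ys : 'cV[R]_m) (I : set R) (z : signals R np nc m) : Prop :=
  [/\ trajectory Gp I (xp z) (up z) (yp z),
      trajectory Gc I (xc z) (uc z) (yc z)
    & forall s, I s -> up z s = w1 s - yc z s /\ uc z s = w2 s + ys].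

(* The event condition |e|^2 > delta |y|^2, with e = y - ys. *)
Definition triggers (R : realType) (m : nat) (delta : R)
    (ys y : 'cV[R]_m) : Prop :=
  dot (y - ys) (y - ys) > delta * dot y y.

Definition agree_on (R : realType) (np nc m : nat) (I : set R)
    (z z' : signals R np nc m) : Prop :=
  forall s, I s ->
    [/\ xp z' s = xp z s, up z' s = up z s & yp z' s = yp z s] /\
    [/\ xc z' s = xc z s, uc z' s = uc z s & yc z' s = yc z s].

(* A run of the event-triggered loop on [t 0, tend), with event times t k.
   The value t k = tend means that no k-th event occurs during the run; with
   tend = +oo the run is global.  States are continuous across events, inputs
   and outputs may jump there.
   By [run_quiet] and [run_event], t k.+1 is the infimum of the times at which
   the event condition holds when the sample taken at t k goes on being held:
   the condition fails before t k.+1, and at some T arbitrarily close to t k.+1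
   it holds for an extension z' to [t k, T] of the current piece of the run on
   which no new sample is taken. *)
Record triggered_loop (R : realType) (np nc m : nat)
    (Gp : system R np m) (Gc : system R nc m) (delta : R)
    (w1 w2 : R -> 'cV[R]_m) (tend : \bar R) (t : nat -> \bar R)
    (z : signals R np nc m) : Prop := TriggeredLoop {
  run_start : t 0%N \is a fin_num;
  run_mono : forall k, (t k <= t k.+1)%E /\ (t k.+1 <= tend)%E;
  run_strict : forall k, (t k < tend)%E -> (t k < t k.+1)%E;
  run_cont : {within ico (t 0%N) tend, continuous (xp z)} /\
             {within ico (t 0%N) tend, continuous (xc z)};
  run_flow : forall k,
    held_loop Gp Gc w1 w2 (yp z (fine (t k))) (ico (t k) (t k.+1)) z;
  run_quiet : forall k s, ico (t k) (t k.+1) s ->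
    ~ triggers delta (yp z (fine (t k))) (yp z s);
  run_event : forall k, (t k.+1 < tend)%E ->
    forall eps : R, 0 < eps ->
    exists (T : R) (z' : signals R np nc m),
      [/\ fine (t k.+1) <= T < fine (t k.+1) + eps,
          held_loop Gp Gc w1 w2 (yp z (fine (t k)))
            [set s | fine (t k) <= s <= T] z',
          agree_on (ico (t k) (t k.+1)) z z'
        & triggers delta (yp z (fine (t k))) (yp z' T)] }.

(* The storage function is chosen before the external signal w1, the event
   times and the run. *)
Definition loop_IF_OFP (R : realType) (np nc m : nat)
    (Gp : system R np m) (Gc : system R nc m) (delta : R)
    (w2 : R -> 'cV[R]_m) (eps0 delta0 : R) : Prop :=
  exists V : 'cV[R]_np * 'cV[R]_nc -> R,
    storage (states Gp `*` states Gc) V /\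
    forall (w1 : R -> 'cV[R]_m) (tend : \bar R) (t : nat -> \bar R)
      (z : signals R np nc m),
      triggered_loop Gp Gc delta w1 w2 tend t z ->
      forall (k : nat) (s : R), ico (t k) (t k.+1) s ->
        rate_le (ico (t k) (t k.+1)) (fun r => V (xp z r, xc z r)) s
          (dot (w1 s) (yp z s) - eps0 * dot (w1 s) (w1 s)
             - delta0 * dot (yp z s) (yp z s)).

Definition beta (R : realType) (rhop delta nuc : R) : R :=
  if 0 < nuc then rhop - nuc - delta * (1 + nuc)
  else if nuc == 0 then rhop - delta
  else rhop + 2 * nuc - delta * (1 - 3 * nuc).

(* Main.v *)
Require Import Defs.
From mathcomp Require Import all_boot all_order all_algebra.
From mathcomp Require Import all_classical all_reals all_analysis.
From mathcomp Require Import ring lra.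
Import Order.TTheory GRing.Theory Num.Theory.
Local Open Scope ring_scope.

(** The sum of the two storage functions is a storage function of the loop.
    Write [w], [u], [y] for the external signal, the plant input and the plant
    output, [v] for the controller output, [ys] for the held sample and
    [e = y - ys].  As [u = w - v] and the controller input is [ys = y - e], the
    cross terms [v.y] of the two supply rates cancel and leave

      [w.y - e.v - nup |w - v|^2 - rhoc |v|^2 - rhop |y|^2 - nuc |ys|^2].

    Young's inequality [- e.v <= |e|^2 + |v|^2 / 4] then separates the signals.
    The terms in [w] and [v] form a quadratic form in which completing the
    square in [v], possible because [rhoc + nup - 1/4 > 0], leaves exactly
    [- nup (rhoc - 1/4) / (rhoc + nup - 1/4) |w|^2]
    ([feedthrough_le]).  What remains,
    [|e|^2 - rhop |y|^2 - nuc |ys|^2], is at most [- beta |y|^2], because the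
    absence of an event means [|e|^2 <= delta |y|^2] ([sampling_le]). *)

Section Dot.
Context {R : realType} {m : nat}.
Implicit Types u v w : 'cV[R]_m.

Lemma dotE u v : dot u v = \sum_i u i 0 * v i 0.
Proof. by rewrite /dot mxE; apply: eq_bigr => i _; rewrite mxE. Qed.

Lemma dotC u v : dot u v = dot v u.
Proof. by rewrite !dotE; apply: eq_bigr => i _; rewrite mulrC. Qed.

Lemma dotBl u v w : dot (u - v) w = dot u w - dot v w.
Proof. by rewrite /dot linearB mulmxBl !mxE. Qed.

Lemma dotBr u v w : dot w (u - v) = dot w u - dot w v.
Proof. by rewrite dotC dotBl !(dotC w). Qed.

Lemma dotZl a u v : dot (a *: u) v = a * dot u v.
Proof. by rewrite /dot linearZ -scalemxAl mxE. Qed.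

Lemma dotZr a u v : dot u (a *: v) = a * dot u v.
Proof. by rewrite dotC dotZl dotC. Qed.

Lemma dot_ge0 u : 0 <= dot u u.
Proof. by rewrite dotE sumr_ge0 // => i _; rewrite -expr2 sqr_ge0. Qed.

(** Young's inequality, with a signed coefficient [b]: this is
    [0 <= |b u - D v|^2] divided by [D]. *)
Lemma dot_young {D : R} (b : R) (u v : 'cV[R]_m) : 0 < D ->
  2 * b * dot u v <= D * dot v v + b ^+ 2 / D * dot u u.
Proof.
move=> D0; have := dot_ge0 (b *: u - D *: v).
rewrite !(dotBl, dotBr, dotZl, dotZr) (dotC v u) => sq0.
rewrite -subr_ge0 -(pmulr_rge0 _ D0); apply: le_trans sq0 _.
rewrite le_eqVlt; apply/orP; left; apply/eqP; field.
by rewrite gt_eqF.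
Qed.

(** The plant is fed [w - v]; its feedforward term and an excess [r] of output
    passivity in [v] dominate a multiple of [|w|^2] alone.  The multiple is the
    Schur complement of the [v]-coefficient [r + nu] of the quadratic form. *)
Lemma feedthrough_le {nu r : R} (w v : 'cV[R]_m) : 0 < r + nu ->
  nu * r / (r + nu) * dot w w <= nu * dot (w - v) (w - v) + r * dot v v.
Proof.
move=> D0; have := dot_young nu w v D0.
have -> : nu * r / (r + nu) = nu - nu ^+ 2 / (r + nu).
  by field; rewrite gt_eqF.
rewrite !(dotBl, dotBr) (dotC v w); lra.
Qed.

(** For [nu >= 0] the term in [|ys|^2] has the right sign and is dropped; for
    [nu < 0] it is bounded by [|ys|^2 <= 2 |y|^2 + 2 |y - ys|^2]. *)
Lemma sampling_le {delta : R} (rho nu : R) (y ys : 'cV[R]_m) : 0 <= delta ->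
  dot (y - ys) (y - ys) <= delta * dot y y ->
  dot (y - ys) (y - ys) - nu * dot ys ys
    <= (rho - beta rho delta nu) * dot y y.
Proof.
move=> d0 quiet.
have yy0 := dot_ge0 y; have dyy0 := mulr_ge0 d0 yy0.
have ss0 := dot_ge0 ys.
rewrite /beta; case: ifPn => [nu_gt0|]; last case: eqP => [-> _|/eqP nu_neq0].
- have nuss0 := mulr_ge0 (ltW nu_gt0) ss0.
  have nuyy0 := mulr_ge0 (ltW nu_gt0) yy0.
  have nudyy0 := mulr_ge0 (ltW nu_gt0) dyy0.
  lra.
- lra.
- rewrite -leNgt => nu_le0; have nuN0 : 0 <= - nu by rewrite oppr_ge0.
  have ss_le : dot ys ys <= 2 * dot y y + 2 * dot (y - ys) (y - ys).
    (* this is [0 <= |2 y - ys|^2] *)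
    have := dot_young 2 y ys ltr01.
    rewrite !(dotBl, dotBr) (dotC ys y); lra.
  have nuss_le := ler_wpM2l nuN0 ss_le.
  have nue_le := ler_wpM2l nuN0 quiet.
  have nudyy0 := mulr_ge0 nuN0 dyy0.
  lra.
Qed.

(** The controller's output excess splits as [rhoc = (rhoc - 1/4) + 1/4]: the
    quarter pays for the sampling error in Young's inequality, and
    [feedthrough_le] uses the rest. *)
Lemma loop_supply_le {nup rhop nuc rhoc delta eps0 delta0 : R}
    (w y v ys : 'cV[R]_m) :
  0 <= delta -> 0 < rhoc - 1 / 4 + nup ->
  eps0 <= nup * (rhoc - 1 / 4) / (rhoc - 1 / 4 + nup) ->
  delta0 <= beta rhop delta nuc ->
  dot (y - ys) (y - ys) <= delta * dot y y ->
  supply nup rhop (w - v) y + supply nuc rhoc ys v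
    <= dot w y - eps0 * dot w w - delta0 * dot y y.
Proof.
move=> d0 D0 eps_le delta0_le quiet.
have ft := feedthrough_le w v D0.
have sm := sampling_le rhop nuc y ys d0 quiet.
have q0 : 0 < 1 / 4 :> R by lra.
have yg := dot_young (- (1 / 2)) (y - ys) v q0.
have ew := ler_wpM2r (dot_ge0 w) eps_le.
have dy := ler_wpM2r (dot_ge0 y) delta0_le.
have c1 : (- (1 / 2)) ^+ 2 / (1 / 4) = 1 :> R by field.
rewrite c1 (dotBl y ys v) in yg.
rewrite /supply (dotBl w v y) (dotC v y); lra.
Qed.

End Dot.

Lemma is_deriv_onD {R : realType} {E : normedModType R} {I : set R}
    {g h : R -> E} {t : R} {dg dh : E} :
  is_deriv_on I g t dg -> is_deriv_on I h t dh ->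
  is_deriv_on I (g \+ h) t (dg + dh).
Proof.
move=> g_dg h_dh; rewrite /is_deriv_on.
under eq_cvg => s do rewrite /= opprD addrACA scalerDr.
exact: cvgD g_dg h_dh.
Qed.

Lemma rate_leD {R : realType} {I : set R} {g h : R -> R} {t a b : R} :
  rate_le I g t a -> rate_le I h t b -> rate_le I (g \+ h) t (a + b).
Proof.
move=> [dg g_dg le_a] [dh h_dh le_b]; exists (dg + dh); last exact: lerD.
exact: (is_deriv_onD g_dg h_dh).
Qed.

Lemma rate_leW {R : realType} {I : set R} {g : R -> R} {t a b : R} :
  a <= b -> rate_le I g t a -> rate_le I g t b.
Proof. by move=> ab [d gd da]; exists d => //; apply: le_trans ab. Qed.

Lemma storage_sum {R : realType} {E F : normedModType R} {X : set E}
    {Y : set F} {V : E -> R} {W : F -> R} :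
  storage X V -> storage Y W ->
  storage (X `*` Y)%classic (fun x => V x.1 + W x.2).
Proof.
move=> VX WY [x y] [/= /VX[V0 dV] /WY[W0 dW]]; split; first exact: addr_ge0.
apply: (@differentiableD _ _ _ (V \o fst) (W \o snd)).
  apply: differentiable_comp; last exact: dV.
  by apply: linear_differentiable => z; exact: cvg_fst.
apply: differentiable_comp; last exact: dW.
by apply: linear_differentiable => z; exact: cvg_snd.
Qed.

Theorem theorem5 (R : realType) (np nc m : nat)
    (Gp : system R np m) (Gc : system R nc m)
    (nup rhop nuc rhoc delta eps0 delta0 : R)
    (hGp : IF_OFP Gp nup rhop) (hGc : IF_OFP Gc nuc rhoc)
    (hdelta : 0 < delta <= 1)
    (hden : 0 < rhoc + nup - 1 / 4)
    (heps0 : eps0 < Num.min nup (nup * (rhoc - 1 / 4) / (rhoc + nup - 1 / 4)))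
    (hdelta0 : 0 <= delta0 <= beta rhop delta nuc) :
  loop_IF_OFP Gp Gc delta (fun=> 0) eps0 delta0.
Proof.
case: hGp => Vp [Vp_storage Vp_rate]; case: hGc => Vc [Vc_storage Vc_rate].
have /andP[/ltW d0 _] := hdelta; have /andP[_ delta0_le] := hdelta0.
rewrite (addrAC rhoc) in hden heps0.
move: heps0; rewrite lt_min => /andP[_ /ltW eps_le].
exists (fun x => Vp x.1 + Vc x.2); split; first exact: storage_sum.
move=> w1 tend t z run k s Is.
have [trp trc wiring] := run_flow run k.
have [upE ucE] := wiring _ Is; rewrite add0r in ucE.
have /negP := run_quiet run Is; rewrite -leNgt => quiet.
have rate := rate_leD (Vp_rate _ _ _ _ _ trp _ Is) (Vc_rate _ _ _ _ _ trc _ Is).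
apply: rate_leW rate; rewrite upE ucE.
exact: loop_supply_le d0 hden eps_le delta0_le quiet.
Qed.
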